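(* Let $M$ be a Riemannian manifold of dimension $n\ge2$ and $v$ a vector field on $M$. Let $\nabla^v$ be the covariant derivative with respect to the connection $\Gamma^v$ and $\nabla^0$ the Levi-Civita covariant derivative. Then for any two vector fields $X,Y$ on $M$, $$\nabla^v_XY=\nabla^0_XY-\frac{2}{n-1}K_v(X,Y),\qquad K_v(X,Y)=\langle Y,v\rangle X-\langle X,Y\rangle v .$$
   Context: The connection $\Gamma^v$ is defined in local coordinates, with $v=\sum_iv^i\frac{\partial}{\partial x_i}$, $g_{ij}=\langle\frac{\partial}{\partial x_i},\frac{\partial}{\partial x_j}\rangle$ and $\Gamma^{0,k}_{ij}$ the Christoffel symbols of the Levi-Civita connection, by the Christoffel symbols $$\Gamma^k_{ij}=\Gamma^{0,k}_{ij}-\frac{2}{n-1}\Big(\delta_{ki}\sum_{\ell=1}^ng_{j\ell}v^\ell-g_{ij}v^k\Big),$$ with the convention that the covariant derivative of $\frac{\partial}{\partial x_j}$ in the direction $\frac{\partial}{\partial x_i}$ is $\sum_k\Gamma^k_{ij}\frac{\partial}{\partial x_k}$. *)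

(* Defs.v *)
From HB Require Import structures.
From mathcomp Require Import all_boot all_order all_algebra.
From mathcomp Require Import boolp classical_sets functions cardinality reals topology normedtype derive.
Import Order.TTheory GRing.Theory Num.Theory numFieldNormedType.Exports.

Set Implicit Arguments.
Unset Strict Implicit.
Unset Printing Implicit Defensive.

Local Open Scope ring_scope.
Local Open Scope classical_set_scope.

(* C^k on the open set [U]; C^(k+1) means differentiable with all partial
   derivatives C^k. *)
Fixpoint Ck (R : realType) (n : nat) (W : normedModType R) (k : nat)
    (U : set 'rV[R]_n) (f : 'rV[R]_n -> W) : Prop :=
  match k with
  | 0%N => forall x, U x -> {for x, continuous f}
  | k'.+1 => (forall x, U x -> differentiable f x) /\
             forall i, Ck k' U (fun x => 'D_(delta_mx 0 i) f x)
  end.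

Definition smooth_on (R : realType) (n : nat) (W : normedModType R)
    (U : set 'rV[R]_n) (f : 'rV[R]_n -> W) := forall k, Ck k U f.

Definition smooth_near (R : realType) (n : nat) (W : normedModType R)
    (a : 'rV[R]_n) (f : 'rV[R]_n -> W) :=
  exists2 U, open_nbhs a U & smooth_on U f.

(* [chart_map] and [chart_inv] are inverse homeomorphisms between the open sets [chart_dom]
   and [chart_map @` chart_dom]; their values elsewhere are irrelevant. *)
Record chart (R : realType) (n : nat) (M : topologicalType) := Chart {
  chart_dom : set M;
  chart_map : M -> 'rV[R]_n;
  chart_inv : 'rV[R]_n -> M;
  chart_dom_open : open chart_dom;
  chart_im_open : open (chart_map @` chart_dom);
  chart_mapK : forall p, chart_dom p -> chart_inv (chart_map p) = p;
  chart_map_cont : forall p, chart_dom p -> {for p, continuous chart_map};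
  chart_inv_cont : forall y, (chart_map @` chart_dom) y -> {for y, continuous chart_inv}
}.

Definition transition (R : realType) (n : nat) (M : topologicalType)
    (phi psi : chart R n M) : 'rV[R]_n -> 'rV[R]_n :=
  chart_map psi \o chart_inv phi.

Definition smooth_transition (R : realType) (n : nat) (M : topologicalType)
    (phi psi : chart R n M) :=
  smooth_on (chart_map phi @` (chart_dom phi `&` chart_dom psi)) (transition phi psi).

Record manifold (R : realType) (n : nat) := Manifold {
  points :> topologicalType;
  _ : hausdorff_space points;
  _ : @second_countable points;
  atlas : set (chart R n points);
  atlas_cover : forall p, exists2 phi, atlas phi & chart_dom phi p;
  atlas_compat : forall phi psi, atlas phi -> atlas psi ->
    smooth_transition phi psi;
  atlas_maximal : forall phi,
    (forall psi, atlas psi ->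
       smooth_transition phi psi /\ smooth_transition psi phi) ->
    atlas phi
}.

Definition around (R : realType) (n : nat) (M : manifold R n) (p : M)
    (phi : chart R n M) := atlas phi /\ chart_dom phi p.


Section TangentSpace.
Context (R : realType) (n : nat) (M : manifold R n).
Implicit Types (p : M) (phi psi : chart R n M).

Let derive_linear (V W : normedModType R) (f : V -> W) x a b (c : R) :
  differentiable f x -> 'D_(c *: a + b) f x = c *: 'D_a f x + 'D_b f x.
Proof. by move=> d; rewrite !deriveE // linearD linearZ. Qed.

Let derive_comp (U V W : normedModType R) (f : U -> V) (g : V -> W) x a :
  differentiable f x -> differentiable g (f x) ->
  'D_('D_a f x) g (f x) = 'D_a (g \o f) x.
Proof.
move=> df dg; rewrite [RHS]deriveE; last exact: differentiable_comp.
by rewrite diff_comp //= !deriveE.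
Qed.

Lemma smooth_transition_diff p phi psi : around p phi -> around p psi ->
  differentiable (transition phi psi) (chart_map phi p).
Proof.
move=> [aphi dphi] [apsi dpsi].
have [H _] := @atlas_compat _ _ M phi psi aphi apsi 1%N.
by apply: H; exists p.
Qed.

Lemma derive_transition p phi psi a b c : around p phi -> around p psi ->
  'D_(c *: a + b) (transition phi psi) (chart_map phi p) =
  c *: 'D_a (transition phi psi) (chart_map phi p) +
  'D_b (transition phi psi) (chart_map phi p).
Proof. by move=> h1 h2; apply: derive_linear; exact: smooth_transition_diff. Qed.

Lemma near_chart p phi psi : around p phi -> around p psi ->
  \forall y \near chart_map phi p, chart_dom psi (chart_inv phi y).
Proof.
move=> ap [_ dp].
have cp : {for chart_map phi p, continuous (chart_inv phi)}.
  by apply: chart_inv_cont; exists p => //; case: ap.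
apply: cp; rewrite chart_mapK; last by case: ap.
by apply: open_nbhs_nbhs; split => //; exact: chart_dom_open.
Qed.

Lemma derive_transition_comp p phi psi chi a :
  around p phi -> around p psi -> around p chi ->
  'D_('D_a (transition phi psi) (chart_map phi p)) (transition psi chi) (chart_map psi p)
  = 'D_a (transition phi chi) (chart_map phi p).
Proof.
move=> ap1 ap2 ap3.
have d12 := smooth_transition_diff ap1 ap2.
have := smooth_transition_diff ap2 ap3.
have -> : chart_map psi p = transition phi psi (chart_map phi p).
  by rewrite /transition /= chart_mapK //; case: ap1.
move=> d23; rewrite (derive_comp _ d12 d23).
apply: near_eq_derive.
have H := near_chart ap1 ap2.
by apply: filterS H => y dy; rewrite /= /transition /= chart_mapK.
Qed.

(* A tangent vector at [p] is given by its components in all charts around [p],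
   related by the differentials of the transition maps.  The value 0 at the
   charts that are not around [p] is a normalisation. *)
Definition tangent_family p : {pred chart R n M -> 'rV[R]_n} :=
  fun xi => `[< (forall phi, ~ around p phi -> xi phi = 0) /\
    (forall phi psi, around p phi -> around p psi ->
       xi psi = 'D_(xi phi) (transition phi psi) (chart_map phi p)) >].

Let tangent_familyP p xi : reflect
    ((forall phi, ~ around p phi -> xi phi = 0) /\
     (forall phi psi, around p phi -> around p psi ->
        xi psi = 'D_(xi phi) (transition phi psi) (chart_map phi p)))
  (xi \in tangent_family p).
Proof. exact: asboolP. Qed.

Record tangent p := Tangent {
  component :> chart R n M -> 'rV[R]_n;
  componentP : component \in tangent_family p
}.

HB.instance Definition _ p := [isSub for @component p].
HB.instance Definition _ p := [Choice of tangent p by <:].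

Lemma tangent_family_submod p : submod_closed (tangent_family p).
Proof.
split.
  apply/tangent_familyP; split=> // phi psi h1 h2 /=.
  by rewrite derive0.
move=> c xi eta /tangent_familyP [z1 t1] /tangent_familyP [z2 t2]; apply/tangent_familyP; split.
  by move=> phi h; rewrite /= !fctE z1 // z2 // scaler0 addr0.
move=> phi psi h1 h2; rewrite !fctE (t1 _ _ h1 h2) (t2 _ _ h1 h2).
by rewrite -derive_transition.
Qed.

HB.instance Definition _ p :=
  GRing.isSubmodClosed.Build R _ (tangent_family p) (tangent_family_submod p).
HB.instance Definition _ p := [SubChoice_isSubLmodule of tangent p by <:].

(* The tangent vector at [p] whose components in the chart [phi] are [a]
   (0 if [phi] is not a chart around [p]). *)
Definition tangent_of_fun phi p (a : 'rV[R]_n) (psi : chart R n M) : 'rV[R]_n :=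
  if `[< around p phi /\ around p psi >]
  then 'D_a (transition phi psi) (chart_map phi p) else 0.

Lemma tangent_of_subproof phi p a : tangent_of_fun phi p a \in tangent_family p.
Proof.
apply/tangent_familyP; split=> [psi h|psi chi h1 h2]; rewrite /tangent_of_fun.
  by case: asboolP => // -[].
have [h|h] := pselect (around p phi); last first.
  by rewrite !asboolF => [|[]|[]] //; rewrite derive0.
by rewrite !asboolT // derive_transition_comp.
Qed.

Definition tangent_of phi p a := Tangent (tangent_of_subproof phi p a).

Definition coord_field phi (i : 'I_n) p : tangent p :=
  tangent_of phi p (delta_mx 0 i).

Definition some_chart p : chart R n M := sval (cid2 (atlas_cover p)).

(* xi(f); by the chain rule it does not depend on the chosen chart. *)
Definition dirderiv p (xi : tangent p) (f : M -> R) : R :=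
  let phi := some_chart p in
  'D_(xi phi) (f \o chart_inv phi : 'rV[R]_n -> R^o) (chart_map phi p).

(* C^infinity near [p]: the transition maps being smooth, one chart around [p]
   suffices. *)
Definition smooth_fun_at p (f : M -> R) :=
  exists2 phi, around p phi &
    smooth_near (chart_map phi p) (f \o chart_inv phi : 'rV[R]_n -> R^o).

Definition smooth_field_at p (X : forall q : M, tangent q) :=
  exists2 phi, around p phi &
    smooth_near (chart_map phi p) (fun y => X (chart_inv phi y) phi).

End TangentSpace.

Record vector_field (R : realType) (n : nat) (M : manifold R n) := VectorField {
  field_at :> forall p : M, tangent p;
  field_smooth : forall p, smooth_field_at p field_at
}.

Record riemannian_metric (R : realType) (n : nat) (M : manifold R n) :=
  RiemannianMetric {
  inner : forall p : M, tangent p -> tangent p -> R;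
  innerC : forall p (a b : tangent p), inner a b = inner b a;
  inner_linear : forall p (c : R) (a b d : tangent p),
    inner (c *: a + b) d = c * inner a d + inner b d;
  inner_gt0 : forall p (a : tangent p), a != 0 -> 0 < inner a a;
  inner_smooth : forall p (X Y : forall q : M, tangent q),
    smooth_field_at p X -> smooth_field_at p Y ->
    smooth_fun_at p (fun q => inner (X q) (Y q))
}.

(* [cov xi Y] is the covariant derivative at [p] of [Y] in the direction
   [xi : tangent p], for [Y] smooth near [p]; it depends on the germ of [Y] at
   [p] only ([cov_leibniz] with [f] the indicator of a neighbourhood of [p]), so
   that it applies to local fields such as [coord_field phi i]. *)
Record connection (R : realType) (n : nat) (M : manifold R n) := Connection {
  cov : forall p : M, tangent p -> (forall q : M, tangent q) -> tangent p;
  cov_linear : forall p (c : R) (xi eta : tangent p) Y, smooth_field_at p Y ->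
    cov (c *: xi + eta) Y = c *: cov xi Y + cov eta Y;
  cov_add : forall p (xi : tangent p) Y Z,
    smooth_field_at p Y -> smooth_field_at p Z ->
    cov xi (fun q => Y q + Z q) = cov xi Y + cov xi Z;
  cov_leibniz : forall p (xi : tangent p) f Y,
    smooth_fun_at p f -> smooth_field_at p Y ->
    cov xi (fun q => f q *: Y q) = dirderiv xi f *: Y p + f p *: cov xi Y;
  cov_smooth : forall p X Y, smooth_field_at p X -> smooth_field_at p Y ->
    smooth_field_at p (fun q => cov (X q) Y)
}.

Section RiemannianGeometry.
Context (R : realType) (n : nat) (M : manifold R n).
Implicit Types (D : connection M) (g : riemannian_metric M) (p : M).
Implicit Types (v : vector_field M) (phi : chart R n M).

(* By the definition of the Lie bracket, [X, Y] f = X (Y f) - Y (X f). *)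
Definition torsion_free D := forall p (X Y : forall q : M, tangent q) f,
  smooth_field_at p X -> smooth_field_at p Y -> smooth_fun_at p f ->
  dirderiv (cov D (X p) Y - cov D (Y p) X) f =
  dirderiv (X p) (fun q => dirderiv (Y q) f) -
  dirderiv (Y p) (fun q => dirderiv (X q) f).

Definition metric_compatible g D :=
  forall p (xi : tangent p) (Y Z : forall q : M, tangent q),
  smooth_field_at p Y -> smooth_field_at p Z ->
  dirderiv xi (fun q => inner g (Y q) (Z q)) =
  inner g (cov D xi Y) (Z p) + inner g (Y p) (cov D xi Z).

Definition levi_civita g D := torsion_free D /\ metric_compatible g D.

(* [christoffel D phi p k i j] is Gamma^k_ij: the [k]-th component of the
   covariant derivative of d/dx_j in the direction d/dx_i. *)
Definition christoffel D phi p (k i j : 'I_n) : R :=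
  cov D (coord_field phi i p) (coord_field phi j) phi 0 k.

Definition metric_coef g phi p (i j : 'I_n) : R :=
  inner g (coord_field phi i p) (coord_field phi j p).

(* [D0] stands for the Levi-Civita connection of [g]. *)
Definition Gamma_v g v D0 phi p (k i j : 'I_n) : R :=
  christoffel D0 phi p k i j -
  2 / (n%:R - 1) *
    ((k == i)%:R * (\sum_l metric_coef g phi p j l * v p phi 0 l) -
     metric_coef g phi p i j * v p phi 0 k).

Definition has_christoffel D
    (Gamma : chart R n M -> M -> 'I_n -> 'I_n -> 'I_n -> R) :=
  forall phi p, around p phi -> forall i j,
    cov D (coord_field phi i p) (coord_field phi j) =
    \sum_k Gamma phi p k i j *: coord_field phi k p.

Definition K_v g v p (X Y : forall q : M, tangent q) : tangent p :=
  inner g (Y p) (v p) *: X p - inner g (X p) (Y p) *: v p.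

End RiemannianGeometry.

(* Main.v *)
Require Import Defs.
From HB Require Import structures.
From mathcomp Require Import all_boot all_order all_algebra.
From mathcomp Require Import boolp classical_sets functions cardinality reals topology normedtype derive.
From mathcomp Require Import landau.
Import Order.TTheory GRing.Theory Num.Theory numFieldNormedType.Exports.
Local Open Scope ring_scope.
Local Open Scope classical_set_scope.

(** The operator K_v is bilinear over functions, so it suffices to compare the
    two connections on the coordinate fields d/dx_i of one chart phi around p.
    Write Y = sum_i y_i d/dx_i near p and X p = sum_j x_j d/dx_j.  Additivity and
    the Leibniz rule give, for every connection D ([cov_expand]),
      D_(X p) Y = sum_i ((X p)(y_i) d/dx_i + sum_j y_i(p) x_j D_(d/dx_j) d/dx_i).
    The terms with derivatives of the y_i do not involve D and cancel in the
    difference of the two connections.  What remains is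
      sum_i sum_j y_i(p) x_j (Dv - D0)_(d/dx_j) d/dx_i,
    where the definition of the Christoffel symbols of Dv reads
      (Dv - D0)_(d/dx_j) d/dx_i = - 2 / (n - 1) K_v(d/dx_j, d/dx_i)
    ([cov_Gamma_v]); summing up by bilinearity ([K_v_expand]) concludes.

    The expansion of Y only holds on the domain of phi, whereas the axioms of a
    connection are about globally defined (possibly non-smooth) fields; the
    passage from one to the other is [cov_local], which applies the Leibniz rule
    to an indicator function. *)

(** * Functions of class C^k *)

Lemma near_eq_differentiable {R : realType} {V W : normedModType R}
    (f g : V -> W) (x : V) :
  {near x, f =1 g} -> differentiable f x -> differentiable g x.
Proof.
move=> fg df.
have gE : g \o shift x = cst (g x) + 'd f x +o_ 0 id.
  apply: eqaddoE; apply/eqaddoP => e e0.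
  have /eqaddoP/(_ e e0) := diff_locally df.
  have fgs : \forall h \near 0, f (h + x) = g (h + x).
    have := fg; rewrite (near_shift 0) /= => H.
    by apply: filterS H => h; rewrite /= subr0.
  apply: filterS2 fgs => h fgh.
  by rewrite !fctE /= -fgh -(nbhs_singleton fg).
by apply/diff_locallyP; rewrite (diff_unique (diff_continuous df) gE);
  split=> //; exact: diff_continuous.
Qed.

(** Being C^k on an open set only depends on the values there. *)
Lemma Ck_congr {R : realType} {n : nat} {W : normedModType R} (k : nat)
    (U V : set 'rV[R]_n) (f g : 'rV[R]_n -> W) :
  open U -> U `<=` V -> (forall x, U x -> f x = g x) -> Ck k V f -> Ck k U g.
Proof.
move=> oU UV; have fgn h h' x : (forall y, U y -> h y = h' y) -> U x ->
    \forall y \near x, h y = h' y :> W.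
  by move=> hh' Ux; apply: filterS (open_nbhs_nbhs (conj oU Ux)).
elim: k f g => [|k IHk] f g fg /=.
  move=> cf x Ux; rewrite /prop_for /continuous_at -(fg _ Ux).
  apply: cvg_trans (cf x (UV x Ux)); exact/(@near_eq_cvg _ _ (nbhs x))/fgn.
move=> [df Df]; split=> [x Ux|i].
  by apply: near_eq_differentiable (df x (UV x Ux)); exact: fgn.
apply: IHk (Df i) => x Ux; apply: near_eq_derive; exact: fgn.
Qed.

Lemma Ck_linear {R : realType} {n : nat} {V W : normedModType R} (k : nat)
    (U : set 'rV[R]_n) (f : 'rV[R]_n -> V) (L : V -> W) :
  linear L -> continuous L -> open U -> Ck k U f -> Ck k U (fun x => L (f x)).
Proof.
move=> linL cL oU; pose LM := GRing.isLinear.Build _ _ _ _ _ linL.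
pose L' : {linear V -> W} := HB.pack L LM.
have dL x : differentiable L x by exact: (@linear_differentiable _ _ _ L').
elim: k f => [|k IHk] f /=.
  by move=> cf x Ux; apply: continuous_comp; [exact: cf|exact: cL].
move=> [df Df]; split=> [x Ux|i].
  by apply: differentiable_comp; [exact: df|exact: dL].
apply: Ck_congr (IHk _ (Df i)) => // x Ux.
have dfx := df x Ux.
rewrite [RHS]deriveE; last exact: differentiable_comp.
by rewrite diff_comp //= deriveE // (@diff_lin _ _ _ L').
Qed.

Lemma Ck_cst {R : realType} {n : nat} {W : normedModType R} (k : nat)
    (U : set 'rV[R]_n) (c : W) : Ck k U (cst c).
Proof.
elim: k c => [|k IHk] c /=; first by move=> x _; exact: cst_continuous.
split=> [x _|i]; first exact: differentiable_cst.
have -> : (fun x : 'rV[R]_n => 'D_(delta_mx 0 i) (cst c) x) = cst 0.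
  by apply/funext => x; rewrite derive_cst.
exact: IHk.
Qed.

(** * Tangent vectors and smooth fields in a chart *)

Section TangentVectors.
Context {R : realType} {n : nat} {M : manifold R n}.
Implicit Types (p q : M) (phi : chart R n M).

Lemma tangent_eq {p phi} (xi eta : tangent p) :
  around p phi -> xi phi = eta phi -> xi = eta.
Proof.
move=> ap e; apply: val_inj; apply/funext => psi /=.
have /asboolP[zx tx] := componentP xi; have /asboolP[ze te] := componentP eta.
have [aps|naps] := pselect (around p psi); last by rewrite zx // ze.
by rewrite (tx phi psi) // (te phi psi) // e.
Qed.

Lemma tangent_of_component {p phi} (a : 'rV[R]_n) :
  around p phi -> tangent_of phi p a phi = a.
Proof.
move=> ap; rewrite /= /tangent_of_fun asboolT //.
rewrite -[RHS](derive_id (chart_map phi p)); apply: near_eq_derive.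
(* the transition map of a chart to itself is the identity near the point *)
have nim : nbhs (chart_map phi p) (chart_map phi @` chart_dom phi).
  apply: open_nbhs_nbhs; split; first exact: chart_im_open.
  by exists p => //; case: ap.
by apply: filterS nim => _ [q dq <-]; rewrite /transition /= chart_mapK.
Qed.

Lemma tangent_sum_component {I : Type} (s : seq I) {p phi}
    (c : I -> R) (xi : I -> tangent p) :
  (\sum_(i <- s) c i *: xi i : tangent p) phi =
  \sum_(i <- s) c i *: xi i phi.
Proof.
rewrite -[LHS]/(val (\sum_(i <- s) c i *: xi i) phi) raddf_sum fct_sumE /=.
by apply: eq_bigr => i _.
Qed.

Lemma tangent_expand {p phi} (xi : tangent p) : around p phi ->
  xi = \sum_i xi phi 0 i *: coord_field phi i p.
Proof.
move=> ap; apply: (tangent_eq _ _ ap); rewrite tangent_sum_component.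
rewrite [LHS]row_sum_delta; apply: eq_bigr => i _.
by rewrite tangent_of_component.
Qed.

(** Smoothness of a field may be read off any local expression of its
    components in one chart. *)
Lemma smooth_field_in_chart {p phi} (X : forall q : M, tangent q)
    (f : 'rV[R]_n -> 'rV[R]_n) :
  around p phi -> smooth_near (chart_map phi p) f ->
  (forall q, around q phi -> X q phi = f (chart_map phi q)) ->
  smooth_field_at p X.
Proof.
move=> ap [U [oU Up] sf] Xf; exists phi => //.
have oI : open (U `&` chart_map phi @` chart_dom phi).
  by apply: openI => //; exact: chart_im_open.
exists (U `&` chart_map phi @` chart_dom phi).
  by split=> //; split=> //; exists p => //; case: ap.
move=> k; apply: (Ck_congr k _ _ _ _ oI _ _ (sf k)) => [x []//|].
move=> _ [_ [q dq <-]]; rewrite chart_mapK // Xf //.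
by split=> //; case: ap.
Qed.

Lemma smooth_coord_field {p phi} i :
  around p phi -> smooth_field_at p (coord_field (M := M) phi i).
Proof.
move=> ap; apply: (smooth_field_in_chart _ (cst (delta_mx 0 i)) ap).
  exists setT; first by split=> //; exact: openT.
  by move=> k; exact: Ck_cst.
by move=> q aq; rewrite tangent_of_component.
Qed.

(** In particular the indicator function of a neighbourhood of [p], whatever it
    does further away, is a smooth function at [p] killed by all derivations. *)
Lemma near_smooth_fun1 {p} {f : M -> R} :
  (\forall q \near p, f q = 1) ->
  smooth_fun_at p f /\ forall xi : tangent p, dirderiv xi f = 0.
Proof.
move=> f1; have nf phi : around p phi ->
    \forall y \near chart_map phi p, f (chart_inv phi y) = 1.
  move=> [_ dp]; have cp : {for chart_map phi p, continuous (chart_inv phi)}.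
    by apply: chart_inv_cont; exists p.
  by apply: (cp [set q | f q = 1]); rewrite chart_mapK.
have ac : around p (some_chart p).
  by rewrite /some_chart; case: cid2.
split=> [|xi].
  exists (some_chart p) => //.
  have := nf _ ac; rewrite /prop_near1 nbhsE => -[U oU Uf]; exists U => // k.
  apply: (Ck_congr k U setT (cst (1 : R^o)) _ (proj1 oU) _ _ (Ck_cst _ _ _)) => //.
  by move=> x /Uf /= ->.
rewrite /dirderiv -[RHS](derive_cst (1 : R^o) (chart_map (some_chart p) p)
  (xi (some_chart p))).
by apply: near_eq_derive; exact: nf ac.
Qed.

End TangentVectors.

(** * Locality and local expression of a connection *)

Section Connections.
Context {R : realType} {n : nat} {M : manifold R n}.
Implicit Types (D : connection M) (p q : M) (phi : chart R n M).

(** The covariant derivative at [p] only depends on the germ of the field. *)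
Lemma cov_local D {p} (xi : tangent p) (Y Z : forall q : M, tangent q) :
  smooth_field_at p Y -> smooth_field_at p Z -> (\forall q \near p, Y q = Z q) ->
  cov D xi Y = cov D xi Z.
Proof.
(* [f] is the indicator function of the set where the fields agree, so that
   [f *: Y] and [f *: Z] are equal everywhere. *)
move=> sY sZ YZ; pose f q : R := if `[< Y q = Z q >] then 1 else 0.
have f1 : \forall q \near p, f q = 1.
  by apply: filterS YZ => q e; rewrite /f asboolT.
have [sf df] := near_smooth_fun1 f1.
have fE X : smooth_field_at p X -> cov D xi X = cov D xi (fun q => f q *: X q).
  move=> sX; rewrite cov_leibniz // df (nbhs_singleton f1).
  by rewrite scale0r add0r scale1r.
rewrite fE // [RHS]fE //; congr (cov _ _ _).
apply: functional_extensionality_dep => q.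
by rewrite /f; case: asboolP => [->|]; rewrite ?scale0r.
Qed.

Lemma cov_sum_dir D {p} {I : Type} (s : seq I) (c : I -> R)
    (xi : I -> tangent p) Y : smooth_field_at p Y ->
  cov D (\sum_(i <- s) c i *: xi i) Y = \sum_(i <- s) c i *: cov D (xi i) Y.
Proof.
move=> sY; elim: s => [|i s IHs]; last by rewrite !big_cons cov_linear // IHs.
have := cov_linear D 1 (0 : tangent p) 0 sY.
rewrite !big_nil scaler0 addr0 scale1r => /(congr1 (fun a => a - cov D 0 Y)).
by rewrite subrr addrK.
Qed.

(** The local formula for a covariant derivative, in terms of the components of
    [Y] and [xi] in a chart and of the derivatives of the coordinate fields. *)
Lemma cov_expand D {p phi} (xi : tangent p) (Y : forall q : M, tangent q) :
  around p phi -> smooth_near (chart_map phi p)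
    (fun y => Y (chart_inv phi y) phi) ->
  cov D xi Y =
  \sum_i (dirderiv xi (fun q => Y q phi 0 i) *: coord_field phi i p +
     \sum_j (Y p phi 0 i * xi phi 0 j) *:
        cov D (coord_field phi j p) (coord_field phi i)).
Proof.
move=> ap [U [oU Up] sU].
(* The partial sums [F s] of the expansion of [Y] are smooth because their
   components are the images of those of [Y] under the linear map [L s]. *)
pose F (s : seq 'I_n) q := \sum_(i <- s) Y q phi 0 i *: coord_field phi i q.
pose L (s : seq 'I_n) (u : 'rV[R]_n) : 'rV[R]_n :=
  \sum_(i <- s) u 0 i *: delta_mx 0 i.
have linL s : linear (L s).
  move=> a u w; rewrite /L scaler_sumr -big_split /=; apply: eq_bigr => i _.
  by rewrite !mxE scalerDl scalerA.
have cL s : continuous (L s).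
  elim: s => [|i s IHs] u.
    have -> : L [::] = cst 0 by apply/funext => w; rewrite /L big_nil.
    exact: cst_continuous.
  have -> : L (i :: s) = (fun w : 'rV[R]_n => w 0 i *: delta_mx 0 i) \+ L s.
    by apply/funext => w; rewrite /L big_cons.
  apply: continuousD; last exact: IHs.
  by apply: continuousZr_tmp; exact: coord_continuous.
have sF s : smooth_field_at p (F s).
  apply: (smooth_field_in_chart _ (fun y => L s (Y (chart_inv phi y) phi)) ap).
    by exists U => // k; apply: Ck_linear => //; exact: sU.
  move=> q [aq dq]; rewrite tangent_sum_component /L chart_mapK //.
  by apply: eq_bigr => i _; rewrite tangent_of_component.
have sc i : smooth_fun_at p (fun q => Y q phi 0 i).
  exists phi => //; exists U => // k.
  apply: (Ck_linear (W := R^o) k U (fun y => Y (chart_inv phi y) phi)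
    (fun u : 'rV[R]_n => u 0 i)) => //; [|exact: coord_continuous].
  by move=> a u w; rewrite !mxE.
have sY : smooth_field_at p Y by exists phi => //; exists U.
have -> : cov D xi Y = cov D xi (F (index_enum 'I_n)).
  apply: cov_local => //.
  have := open_nbhs_nbhs (conj (chart_dom_open phi) (proj2 ap)).
  by apply: filterS => q dq; apply: tangent_expand; split=> //; case: ap.
(* Induction on the outer sum only: the sums over [j] keep their full range. *)
elim: {1 2}(index_enum _) => [|i s IHs].
  rewrite big_nil.
  have F0 q : F [::] q = 0 by rewrite /F big_nil.
  have := cov_add D xi (sF [::]) (sF [::]).
  have -> : (fun q => F [::] q + F [::] q) = F [::].
    by apply: functional_extensionality_dep => q; rewrite F0 addr0.
  (* the field [F [::]] vanishes, so [cov] maps it to an [a] with [a = a + a] *)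
  by move=> /(congr1 (fun a => a - cov D xi (F [::]))); rewrite subrr addrK.
have sci := smooth_coord_field i ap.
rewrite big_cons -IHs.
have -> : F (i :: s) = fun q => Y q phi 0 i *: coord_field phi i q + F s q.
  by apply: functional_extensionality_dep => q; rewrite /F big_cons.
rewrite cov_add //; last first.
  have := sF [:: i]; congr smooth_field_at.
  by apply: functional_extensionality_dep => q; rewrite /F big_seq1.
rewrite cov_leibniz //; congr (_ + _ + _).
rewrite {1}(tangent_expand xi ap) cov_sum_dir // scaler_sumr.
by apply: eq_bigr => j _; rewrite scalerA.
Qed.

End Connections.

(** * Comparison of the connections on coordinate fields *)

Section Comparison.
Context {R : realType} {n : nat} {M : manifold R n} (g : riemannian_metric M).

Lemma inner_suml {p : M} {I : Type} (s : seq I) (c : I -> R)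
    (xi : I -> tangent p) (eta : tangent p) :
  inner g (\sum_(i <- s) c i *: xi i) eta = \sum_(i <- s) c i * inner g (xi i) eta.
Proof.
elim: s => [|i s IHs]; last by rewrite !big_cons inner_linear IHs.
have := inner_linear g 1 (0 : tangent p) 0 eta.
rewrite !big_nil scaler0 addr0 mul1r => /(congr1 (fun a => a - inner g 0 eta)).
by rewrite subrr addrK.
Qed.

Lemma inner_sumr {p : M} {I : Type} (s : seq I) (c : I -> R)
    (xi : I -> tangent p) (eta : tangent p) :
  inner g eta (\sum_(i <- s) c i *: xi i) = \sum_(i <- s) c i * inner g eta (xi i).
Proof.
by rewrite innerC inner_suml; apply: eq_bigr => i _; rewrite innerC.
Qed.

(** [K_v] is tensorial: it is determined by its values on coordinate fields. *)
Lemma K_v_expand (v : vector_field M) {p : M} {phi : chart R n M}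
    (X Y : forall q : M, tangent q) : around p phi ->
  K_v g v p X Y =
  \sum_i \sum_j (Y p phi 0 i * X p phi 0 j) *:
     K_v g v p (coord_field phi j) (coord_field phi i).
Proof.
move=> ap; rewrite /K_v.
under eq_bigr => i _ do under eq_bigr => j _ do rewrite scalerBr !scalerA.
under eq_bigr => i _ do rewrite sumrB.
rewrite sumrB; congr (_ - _).
  rewrite {1}(tangent_expand (Y p) ap) {1}(tangent_expand (X p) ap).
  rewrite inner_suml scaler_suml; apply: eq_bigr => i _.
  rewrite scaler_sumr; apply: eq_bigr => j _.
  by rewrite scalerA mulrAC.
rewrite {1}(tangent_expand (Y p) ap) {1}(tangent_expand (X p) ap).
rewrite inner_sumr scaler_suml; apply: eq_bigr => i _.
rewrite inner_suml mulr_sumr scaler_suml; apply: eq_bigr => j _.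
by rewrite mulrA.
Qed.

(** The statement to be proved, for two coordinate fields: the Kronecker symbol
    in the Christoffel symbols gives the summand along the first field, and the
    other summand is along [v]. *)
Lemma cov_Gamma_v (v : vector_field M) (D0 Dv : connection M) {p : M}
    {phi : chart R n M} (i j : 'I_n) :
  has_christoffel Dv (Gamma_v g v D0) -> around p phi ->
  cov Dv (coord_field phi i p) (coord_field phi j) =
  cov D0 (coord_field phi i p) (coord_field phi j) -
  (2 / (n%:R - 1)) *: K_v g v p (coord_field phi i) (coord_field phi j).
Proof.
move=> hDv ap; rewrite hDv // /Gamma_v; move: (2 / _) => c.
under eq_bigr => k _ do rewrite scalerBl -scalerA scalerBl -!scalerA.
rewrite sumrB -scaler_sumr sumrB -scaler_sumr.
congr (_ - _ *: (_ - _)); first by rewrite [RHS](tangent_expand _ ap).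
  rewrite (bigD1 i) //= eqxx scale1r [X in _ + X]big1 ?addr0; last first.
    by move=> k /negbTE ->; rewrite scale0r.
  rewrite [in RHS](tangent_expand (v p) ap) inner_sumr; congr (_ *: _).
  by apply: eq_bigr => l _; rewrite mulrC.
by rewrite [in RHS](tangent_expand (v p) ap).
Qed.

End Comparison.

Theorem proposition3p3 (R : realType) (n : nat) (hn : (2 <= n)%N)
    (M : manifold R n) (g : riemannian_metric M) (v : vector_field M)
    (D0 : connection M) (hD0 : levi_civita g D0)
    (Dv : connection M) (hDv : has_christoffel Dv (Gamma_v g v D0))
    (X Y : vector_field M) (p : M) :
  cov Dv (X p) Y = cov D0 (X p) Y - (2 / (n%:R - 1)) *: K_v g v p X Y.
Proof.
have [phi ap sY] := field_smooth Y p.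
rewrite !(cov_expand _ _ _ ap sY) (K_v_expand g v X Y ap).
rewrite scaler_sumr -sumrB; apply: eq_bigr => i _.
rewrite -addrA; congr (_ + _).
rewrite scaler_sumr -sumrB; apply: eq_bigr => j _.
by rewrite (cov_Gamma_v g v _ _ _ _ hDv ap)
  scalerBr !scalerA [_ * (_ * _)]mulrC.
Qed.
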